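(* Let $n\ge 3$ and let $A_1,A_2\in\mathbb{R}^{n\times n}$ be symmetric matrices. (i) Suppose $E=\{x\in\mathbb{R}^n: x^TA_1x=1,\ x^TA_2x=1\}$ is nonempty. Then $E$ is compact if and only if there exist $\mu_1,\mu_2\in\mathbb{R}$ such that $\mu_1A_1+\mu_2A_2\succ 0$. (ii) Suppose $F=\{x\in\mathbb{R}^n: x^TA_1x=1,\ x^TA_2x\le 1\}$ is nonempty. Then $F$ is compact if and only if there exists a scalar $\mu\in\mathbb{R}$ such that $\mu A_1+A_2\succ 0$.
   Context: $M\succ 0$ means that the symmetric matrix $M$ is positive definite. *)

(* Defs.v *)
From HB Require Import structures.
From mathcomp Require Import all_boot all_order all_algebra.
From mathcomp Require Import all_classical all_reals all_analysis.

Set Implicit Arguments.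
Unset Strict Implicit.
Unset Printing Implicit Defensive.

Import Order.TTheory GRing.Theory Num.Theory.
Import numFieldNormedType.Exports.

Local Open Scope classical_set_scope.
Local Open Scope ring_scope.

(* x^T M x, read off as the single entry of a 1 x 1 matrix *)
Definition qform (R : realType) (n : nat) (M : 'M[R]_n) (x : 'cV[R]_n) : R :=
  (x^T *m M *m x) 0 0.

Definition posdefmx (R : realType) (n : nat) (M : 'M[R]_n) : Prop :=
  M \is symmetricmx /\ forall x : 'cV[R]_n, x != 0 -> 0 < qform M x.

Definition setE (R : realType) (n : nat) (A1 A2 : 'M[R]_n) : set 'cV[R]_n :=
  [set x | qform A1 x = 1 /\ qform A2 x = 1].

Definition setF (R : realType) (n : nat) (A1 A2 : 'M[R]_n) : set 'cV[R]_n :=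
  [set x | qform A1 x = 1 /\ qform A2 x <= 1].

(* Main.v *)
Require Import Defs.
From HB Require Import structures.
From mathcomp Require Import all_boot all_order all_algebra.
From mathcomp Require Import all_classical all_reals all_analysis.
From mathcomp Require Import ring lra.

Set Implicit Arguments.
Unset Strict Implicit.
Unset Printing Implicit Defensive.

Import Order.TTheory GRing.Theory Num.Theory.
Import numFieldNormedType.Exports.

Local Open Scope classical_set_scope.
Local Open Scope ring_scope.

(** The theorem rests on a connectedness argument followed by an S-lemma.  Write
q1, q2 for the two forms, q := q2 - q1, and I for the sum of squares.  Then E is
the slice q1 = 1 of the cone D := {q = 0}, and F is the slice q1 = 1 of the cone
D := {q <= 0}.

If some combination of A1 and A2 is positive definite, it dominates I up to a
constant ([posdef_coercive]) and is bounded above on the slice, so the slice is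
closed and bounded.

Conversely, let the slice be compact, and let C be the maximum of I on it.
By homogeneity, I <= C q1 at every point of D where q1 > 0.  Hence the form
Q := C q1 - I / 2 is positive somewhere on D and vanishes on D only at 0
([compact_slice]).  The cone D minus the origin is connected up to sign, so Q is
positive on all of it ([pos_on_qform_le0], [pos_on_qform_eq0]).  For {q <= 0} a
segment joins x to d or to - d inside the cone.  For {q = 0} two non-orthogonal
isotropic vectors span a hyperbolic plane, which meets the cone in two lines
only, and the path has to leave that plane through a third vector that is
q-orthogonal to both; this is where n >= 3 is used.

Finsler's lemma ([finsler]) then gives l with Q + l q >= 0, that is
C q1 + l (q2 - q1) >= I / 2, a positive definite combination.  Keeping half of I
in reserve in the definition of Q is what makes the weak inequality in Finsler's
lemma sufficient.  For F the coefficient of q2 must moreover be made positive: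
l can be taken nonnegative because Q > 0 where q <= 0, and a small multiple of q,
absorbed by I / 2, makes it strictly positive. *)

(** * Bilinear and quadratic forms of a matrix *)

Definition bform (R : realType) (n : nat) (M : 'M[R]_n) (x y : 'cV[R]_n) : R :=
  (x^T *m M *m y) 0 0.

Lemma exists_kernel_vector (K : fieldType) m n (A : 'M[K]_(m, n)) :
  (m < n)%N -> exists2 e : 'cV[K]_n, e != 0 & A *m e = 0.
Proof.
move=> mn; have k0 : kermx A^T != 0.
  rewrite -mxrank_eq0 mxrank_ker subn_eq0 -ltnNge.
  by rewrite (leq_ltn_trans (rank_leq_col _)).
exists (nz_row (kermx A^T))^T; first by rewrite trmx_eq0 nz_row_eq0.
apply/eqP; rewrite -trmx_eq0 trmx_mul trmxK; apply/eqP/sub_kermxP.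
exact: nz_row_sub.
Qed.

Section Algebra.
Variables (R : realType) (n : nat).
Implicit Types (M N : 'M[R]_n) (x y z : 'cV[R]_n) (a b c : R).

Lemma bformDl M x y z : bform M (x + y) z = bform M x z + bform M y z.
Proof. by rewrite /bform linearD/= !mulmxDl mxE. Qed.

Lemma bformDr M x y z : bform M z (x + y) = bform M z x + bform M z y.
Proof. by rewrite /bform mulmxDr mxE. Qed.

Lemma bformZl M a x y : bform M (a *: x) y = a * bform M x y.
Proof. by rewrite /bform linearZ/= -!scalemxAl mxE. Qed.

Lemma bformZr M a x y : bform M x (a *: y) = a * bform M x y.
Proof. by rewrite /bform -!scalemxAr mxE. Qed.

Lemma symmetricmxP M : reflect (M = M^T) (M \is symmetricmx).
Proof.
by apply: (iffP (is_hermitianmxP false idfun M)); rewrite expr0 scale1r map_mx_id.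
Qed.

Lemma bformC M x y : M \is symmetricmx -> bform M x y = bform M y x.
Proof.
move=> /symmetricmxP sM; rewrite /bform -[RHS]trace_mx11 -mxtrace_tr trace_mx11.
by rewrite !trmx_mul trmxK -sM mulmxA.
Qed.

Lemma qform_bform M x : qform M x = bform M x x.
Proof. by []. Qed.

Lemma qformZ M a x : qform M (a *: x) = a ^+ 2 * qform M x.
Proof. by rewrite !qform_bform bformZl bformZr mulrA. Qed.

Lemma qform0 M : qform M 0 = 0.
Proof. by rewrite /qform mulmx0 mxE. Qed.

Lemma qformDm M N x : qform (M + N) x = qform M x + qform N x.
Proof. by rewrite /qform mulmxDr mulmxDl mxE. Qed.

Lemma qformZm M a x : qform (a *: M) x = a * qform M x.
Proof. by rewrite /qform -scalemxAr -scalemxAl mxE. Qed.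

Lemma qformNm M x : qform (- M) x = - qform M x.
Proof. by rewrite -scaleN1r qformZm mulN1r. Qed.

Lemma qform_comb M a b x y : M \is symmetricmx ->
  qform M (a *: x + b *: y) =
  a ^+ 2 * qform M x + a * b * bform M x y *+ 2 + b ^+ 2 * qform M y.
Proof.
move=> sM; rewrite !qform_bform !(bformDl, bformDr, bformZl, bformZr).
by rewrite (bformC y x sM); ring.
Qed.

Lemma qformN M x : qform M (- x) = qform M x.
Proof. by rewrite -scaleN1r qformZ sqrrN expr1n mul1r. Qed.

Lemma bformNr M x y : bform M x (- y) = - bform M x y.
Proof. by rewrite -scaleN1r bformZr mulN1r. Qed.

Lemma qform1E x : qform 1%:M x = \sum_i x i 0 ^+ 2.
Proof. by rewrite /qform mulmx1 mxE; apply: eq_bigr => i _; rewrite mxE. Qed.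

Lemma coord_le_qform1 x i : x i 0 ^+ 2 <= qform 1%:M x.
Proof.
by rewrite qform1E (bigD1 i)//= lerDl sumr_ge0// => j _; rewrite sqr_ge0.
Qed.

Lemma qform1_ge0 x : 0 <= qform 1%:M x.
Proof. by rewrite qform1E sumr_ge0// => j _; rewrite sqr_ge0. Qed.

Lemma qform1_gt0 x : x != 0 -> 0 < qform 1%:M x.
Proof.
move=> x0; rewrite lt_neqAle qform1_ge0 andbT; apply: contra x0 => /eqP q0.
apply/eqP/matrixP => i j; rewrite ord1 mxE; apply/eqP.
by rewrite -sqrf_eq0 eq_le sqr_ge0 andbT [leRHS]q0 coord_le_qform1.
Qed.

Lemma symmetricmxD M N : M \is symmetricmx -> N \is symmetricmx ->
  M + N \is symmetricmx.
Proof.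
move=> /symmetricmxP sM /symmetricmxP sN; apply/symmetricmxP.
by rewrite linearD/= -sM -sN.
Qed.

Lemma symmetricmxZ a M : M \is symmetricmx -> a *: M \is symmetricmx.
Proof.
by move=> /symmetricmxP sM; apply/symmetricmxP; rewrite linearZ/= -sM.
Qed.

Lemma symmetricmx1 : (1%:M : 'M[R]_n) \is symmetricmx.
Proof. by apply/symmetricmxP; rewrite trmx1. Qed.

(** This is where dimension at least 3 enters: orthogonality to two vectors is
two linear conditions. *)
Lemma exists_orthogonal2 N x d : (3 <= n)%N ->
  exists e, [/\ e != 0, bform N x e = 0 & bform N d e = 0].
Proof.
move=> n3; pose A := col_mx (x^T *m N) (d^T *m N).
have [e e0 Ae] := @exists_kernel_vector _ (1 + 1) n A n3.
exists e; move: Ae; rewrite mul_col_mx => /eqP; rewrite col_mx_eq0.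
by move=> /andP[/eqP xe /eqP de]; rewrite /bform xe de mxE.
Qed.

End Algebra.

Section Forms.
Variables (R : realType) (n : nat).
Implicit Types (M N : 'M[R]_n) (x y z : 'cV[R]_n) (a b c : R).

(** * Continuity and compactness *)

Lemma qform_continuous M : continuous (qform M).
Proof.
have -> : qform M = fun x => \sum_j (\sum_i x i 0 * M i j) * x j 0.
  apply/funext => x; rewrite /qform mxE; apply: eq_bigr => j _.
  by rewrite mxE; congr (_ * _); apply: eq_bigr => i _; rewrite mxE.
have cj j : continuous (fun x : 'cV[R]_n => \sum_i x i 0 * M i j).
  apply: continuous_big => [|i _]; first exact: add_continuous.
  move=> x; apply: continuousM; first exact: coord_continuous.
  exact: cst_continuous.
apply: continuous_big => [|j _]; first exact: add_continuous.
by move=> x; apply: continuousM; [exact: cj|exact: coord_continuous].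
Qed.

Lemma trmx_continuous p q : continuous (@trmx R p q).
Proof.
move=> A s /= /nbhs_ballP[e e0 es]; apply/nbhs_ballP; exists e => //= B [_ AB].
by apply: es; split=> // i j; rewrite !mxE; exact: AB.
Qed.

(** Heine-Borel in column form: the coordinates are bounded by c + 1, so the set
lies in the transpose of a box of row vectors, which is compact by Tychonoff. *)
Lemma compact_qform1_bounded c (S : set 'cV[R]_n) : closed S ->
  S `<=` [set x | qform 1%:M x <= c] -> compact S.
Proof.
move=> Sc SB.
pose B := [set v : 'rV[R]_n | forall i, v ord0 i \in `[- (c + 1), c + 1]].
have cB : compact B.
  apply: (@rV_compact _ _ (fun=> `[- (c + 1), c + 1]%classic)) => _.
  exact: segment_compact.
have cB' : compact (trmx @` B).
  apply: continuous_compact cB; apply: continuous_subspaceT.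
  exact: trmx_continuous.
apply: subclosed_compact Sc cB' _ => x /SB /= xc; exists x^T; last exact: trmxK.
move=> i; rewrite /= mxE in_itv/= -ler_norml.
have c0 : 0 <= c := le_trans (qform1_ge0 x) xc.
rewrite -(@ler_pXn2r _ 2)// ?nnegrE ?addr_ge0// real_normK ?num_real//.
(* c <= (c + 1)^2 spares a square root in the size of the box *)
have := coord_le_qform1 x i; nra.
Qed.

Lemma closed_qform_le M c : closed [set x | qform M x <= c].
Proof.
exact: (continuous_closedP _).1 (@qform_continuous M) _ (@closed_le R c).
Qed.

Lemma closed_qform_eq M c : closed [set x | qform M x = c].
Proof.
exact: (continuous_closedP _).1 (@qform_continuous M) _ (@closed_eq R c).
Qed.

Lemma qform_ge0_sphere M :
  (forall y, qform 1%:M y = 1 -> 0 <= qform M y) -> forall x, 0 <= qform M x.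
Proof.
move=> M0 x; have [->|/qform1_gt0 x0] := eqVneq x 0; first by rewrite qform0.
have := M0 ((Num.sqrt (qform 1%:M x))^-1 *: x).
rewrite !qformZ exprVn sqr_sqrtr ?(ltW x0)// mulVf ?gt_eqF// => /(_ erefl).
by rewrite pmulr_rge0// invr_gt0.
Qed.

(** On the part K of the unit sphere where [M <= 0], the form [N] is bounded below
by a positive constant since K is compact, so a large multiple of [N] compensates
[M] there; off K there is nothing to compensate. *)
Lemma qform_dominated M N :
  (forall x, 0 <= qform N x) ->
  (forall x, x != 0 -> qform N x = 0 -> 0 < qform M x) ->
  exists2 l, 0 < l & forall x, 0 <= qform M x + l * qform N x.
Proof.
move=> N0 M0.
pose K := [set x | qform 1%:M x = 1] `&` [set x | qform M x <= 0].
have KN x : K x -> 0 < qform N x.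
  move=> [x1 xM]; rewrite lt_neqAle N0 andbT eq_sym; apply: contraTN isT => /eqP.
  move=> /M0 H; have : 0 < qform M x.
    apply: H; apply/eqP => x0; move: x1; rewrite x0 /= qform0 => /eqP.
    by rewrite eq_sym oner_eq0.
  by rewrite ltNge xM.
have [K0|/eqP/set0P K0] := pselect (K = set0).
  exists 1 => // x; rewrite mul1r -qformDm; move: x.
  apply: qform_ge0_sphere => y y1; rewrite qformDm addr_ge0//.
  rewrite leNgt; apply/negP => /ltW My.
  by have : K y by []; rewrite K0.
have cK : compact K.
  apply: (@compact_qform1_bounded 1).
    by apply: closedI; [exact: closed_qform_eq|exact: closed_qform_le].
  by move=> x [/= -> _].
have ct T : {within K, continuous (qform T)}.
  by apply: continuous_subspaceT; exact: qform_continuous.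
have [a /set_mem/KN Na amin] := compact_EVT_min K0 cK (ct N).
have [b /set_mem[_ Mb] bmin] := compact_EVT_min K0 cK (ct M).
have lK : 0 < 1 - qform M b / qform N a.
  by rewrite -mulNr ltr_pwDl// divr_ge0// ?oppr_ge0// ltW.
exists (1 - qform M b / qform N a) => // x.
rewrite -qformZm -qformDm; move: x; apply: qform_ge0_sphere => y y1.
rewrite qformDm qformZm.
have [My|My] := ltP 0 (qform M y).
  by rewrite addr_ge0 ?mulr_ge0// ltW.
have Ky : y \in K by apply/mem_set; split.
have h : - qform M b / qform N a * qform N y >= - qform M b.
  rewrite -{1}[- qform M b](divfK (lt0r_neq0 Na)) ler_wpM2l ?amin//.
  by rewrite divr_ge0// ?oppr_ge0// ltW.
have := bmin y Ky; have := N0 y; move: h; rewrite !mulNr; nra.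
Qed.

(** Domination of - I, where the hypothesis on the zeros of [M] is vacuous. *)
Lemma posdef_coercive M : posdefmx M ->
  exists2 l, 0 < l & forall x, qform 1%:M x <= l * qform M x.
Proof.
move=> [sM M0].
have Mge0 x : 0 <= qform M x.
  by have [->|/M0/ltW//] := eqVneq x 0; rewrite qform0.
have [x x0 Mx|l l0 lP] := @qform_dominated (- 1%:M) M Mge0.
  by have := M0 x x0; rewrite Mx ltxx.
by exists l => // x; have := lP x; rewrite qformNm addrC subr_ge0.
Qed.

Lemma qform1_dominates M : exists2 l, 0 < l &
  forall x, 0 <= qform M x + l * qform 1%:M x.
Proof.
apply: qform_dominated => [x|x x0 x1]; first exact: qform1_ge0.
by have := qform1_gt0 x0; rewrite x1 ltxx.
Qed.

(** * Finsler's lemma *)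

(** The line through u in the direction of v meets {N = 0} at two points, lying on
opposite sides of u; the positive weights that average them to a multiple of u
also remove the cross term bform M u v from the average of the values of [M]. *)
Lemma finsler_pair M N u v : M \is symmetricmx -> N \is symmetricmx ->
  (forall x, qform N x = 0 -> 0 <= qform M x) ->
  0 < qform N u -> qform N v < 0 ->
  qform M u * qform N v <= qform M v * qform N u.
Proof.
move=> sM sN MN Nu Nv; set b := bform N u v.
set s := Num.sqrt (b ^+ 2 - qform N u * qform N v).
have uv : qform N u * qform N v < 0 by rewrite pmulr_rlt0.
have s2 : s ^+ 2 = b ^+ 2 - qform N u * qform N v.
  by rewrite sqr_sqrtr// subr_ge0 (le_trans (ltW uv))// sqr_ge0.
have s0 : 0 < s by rewrite sqrtr_gt0 subr_gt0 (lt_le_trans uv)// sqr_ge0.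
have bs : `|b| <= s.
  rewrite -(@ler_pXn2r _ 2)// ?nnegrE ?(ltW s0)// real_normK ?num_real//.
  by rewrite s2 lerDl oppr_ge0 ltW.
move: bs; rewrite ler_norml => /andP[bs1 bs2].
(* r = s and r = - s give the two points, scaled by qform N v to avoid division *)
have H (r : R) : r ^+ 2 = s ^+ 2 ->
    0 <= qform M (qform N v *: u + (- b + r) *: v).
  move=> r2; apply: MN; rewrite qform_comb// -/b.
  transitivity (qform N v * (qform N v * qform N u - b ^+ 2 + r ^+ 2)).
    by ring.
  by rewrite r2 s2; ring.
have Hp : 0 <= qform M (qform N v *: u + (- b + s) *: v) by exact: H.
have Hm : 0 <= qform M (qform N v *: u + (- b - s) *: v).
  by apply: H; rewrite sqrrN.
move: Hp Hm; rewrite !qform_comb//.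
set B := bform M u v; set p := qform N u; set q := qform N v.
set P := qform M u; set Q := qform M v => Hp Hm.
have bp : 0 <= s + b by lra.
have bm : 0 <= s - b by lra.
(* the weights s + b and s - b cancel the coefficient of B *)
have h : 0 <= 2 * s * (- q) * (p * Q - q * P).
  have /= := addr_ge0 (mulr_ge0 bp Hp) (mulr_ge0 bm Hm).
  rewrite (_ : _ + _ = 2 * s * (q ^+ 2 * P + (s ^+ 2 - b ^+ 2) * Q)); last first.
    by ring.
  by rewrite s2 -/p -/q; congr (_ <= _); ring.
move: h; rewrite pmulr_rge0; first by rewrite subr_ge0 mulrC (mulrC Q).
by rewrite mulr_gt0 ?oppr_gt0// mulr_gt0.
Qed.

(** When [N] takes both signs, each vector u with N u > 0 imposes a lower bound on
l and each v with N v < 0 an upper bound; [finsler_pair] says that every lower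
bound is at most every upper bound, so their supremum works.  When [N] is
semidefinite only one kind of bound occurs, and [qform_dominated] is needed to
know that they are not unbounded. *)
Lemma finsler M N : M \is symmetricmx -> N \is symmetricmx ->
  (forall x, x != 0 -> qform N x = 0 -> 0 < qform M x) ->
  exists l, forall x, 0 <= qform M x + l * qform N x.
Proof.
move=> sM sN MN.
have [[v Nv]|nv] := pselect (exists v, qform N v < 0); last first.
  have [|l _ ?] := @qform_dominated M N _ MN; last by exists l.
  by move=> x; rewrite leNgt; apply/negP => Nx; apply: nv; exists x.
have [[u Nu]|nu] := pselect (exists u, 0 < qform N u); last first.
  have [x|x x0|l _ lP] := @qform_dominated M (- N).
  - by rewrite qformNm oppr_ge0 leNgt; apply/negP => Nx; apply: nu; exists x.
  - by rewrite qformNm => /eqP; rewrite oppr_eq0 => /eqP; exact: MN.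
  - by exists (- l) => x; have := lP x; rewrite qformNm mulrN mulNr.
have MN' x : qform N x = 0 -> 0 <= qform M x.
  by have [->|x0 /(MN _ x0)/ltW] := eqVneq x 0; rewrite ?qform0.
have uv := fun x y => @finsler_pair M N x y sM sN MN'.
pose E := [set - qform M x / qform N x | x in [set x | 0 < qform N x]].
have ubE y : qform N y < 0 -> ubound E (qform M y / - qform N y).
  move=> Ny _ [x /= Nx <-]; rewrite ler_pdivrMr// mulrAC ler_pdivlMr ?oppr_gt0//.
  by rewrite mulrNN; exact: uv.
have E0 : E !=set0 by exists (- qform M u / qform N u); exists u.
exists (sup E) => x; have [Nx|Nx|Nx] := ltgtP (qform N x) 0.
- have := ge_sup E0 (ubE _ Nx); rewrite ler_pdivlMr ?oppr_gt0// mulrN.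
  by rewrite lerNl -subr_ge0 opprK addrC.
- have /ub_le_sup : has_ubound E by exists (qform M v / - qform N v); exact: ubE.
  move=> /(_ (- qform M x / qform N x)); rewrite ler_pdivrMr//.
  by rewrite -lerBlDl sub0r; apply; exists x.
- by rewrite Nx mulr0 addr0 MN'.
Qed.

(** * Connectedness of quadratic cones *)

(** The quadratic parametrization from x to d is chosen so that, for e
N-orthogonal to x and d and for isotropic x and d, the value of N along the path
is (1 - t)^2 t^2 (2 bform N x d + N e): a suitable scaling of e makes the whole
path isotropic.  With e = 0 it is, up to positive scalars, the segment. *)
Lemma qform_root_on_path M x d e :
  0 < qform M x -> qform M d < 0 ->
  exists2 t : R, 0 <= t <= 1 &
    qform M ((1 - t) ^+ 2 *: x + t ^+ 2 *: d + ((1 - t) * t) *: e) = 0.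
Proof.
move=> Mx Md.
pose g (t : R) := (1 - t) ^+ 2 *: x + t ^+ 2 *: d + ((1 - t) * t) *: e.
have cg : continuous g.
  have c1 : continuous (fun t : R => 1 - t).
    by move=> t; apply: cvgB; [exact: cvg_cst|exact: cvg_id].
  move=> t; apply: cvgD; first apply: cvgD.
  - apply: cvgZ; last exact: cvg_cst.
    by rewrite expr2; apply: cvgM; exact: c1.
  - apply: cvgZ; last exact: cvg_cst.
    by rewrite expr2; apply: cvgM; exact: cvg_id.
  - apply: cvgZ; last exact: cvg_cst.
    by apply: cvgM; [exact: c1|exact: cvg_id].
have cf : continuous (qform M \o g).
  by move=> t; apply: continuous_comp; [exact: cg|exact: qform_continuous].
have f0 : (qform M \o g) 0 = qform M x.
  by rewrite /= /g subr0 expr1n expr0n/= !scale0r scale1r mulr0 scale0r !addr0.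
have f1 : (qform M \o g) 1 = qform M d.
  rewrite /= /g subrr expr1n expr0n/= !scale0r scale1r mul0r scale0r.
  by rewrite add0r addr0.
have [||t t01 gt] := @IVT R (qform M \o g) 0 1 0 ler01.
- exact: continuous_subspaceT.
- by rewrite f0 f1 ge_min le_max (ltW Mx) (ltW Md) orbT.
- by exists t => //; move: t01; rewrite in_itv.
Qed.

(** The root is not the trivial one at the origin: the segment passes through 0
only if d is a multiple of x, and then M d has the sign of M x. *)
Lemma qform_root_on_segment M x d : 0 < qform M x -> qform M d < 0 ->
  exists t : R, let y := (1 - t) ^+ 2 *: x + t ^+ 2 *: d in
    y != 0 /\ qform M y = 0.
Proof.
move=> Mx Md; have [t _] := @qform_root_on_path M x d 0 Mx Md.
rewrite scaler0 addr0 => yt; exists t; split=> //; apply/eqP => /eqP.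
rewrite addr_eq0 => /eqP /(congr1 (qform M)).
rewrite -scaleNr !qformZ => h.
have [t1|t1] := eqVneq t 1.
  move: h; rewrite t1 subrr expr0n/= expr0n/= mul0r expr1n sqrrN expr1n mul1r.
  by move=> h; rewrite -h ltxx in Md.
have : 0 < ((1 - t) ^+ 2) ^+ 2 * qform M x.
  by rewrite mulr_gt0// !exprn_even_gt0//= ?sqrf_eq0 subr_eq0 eq_sym.
rewrite h; apply/negP; rewrite -leNgt.
by rewrite mulr_ge0_le0 ?sqr_ge0// ltW.
Qed.

(** Replacing d by - d makes the cross term nonpositive, and then the segment from
x to d stays in the cone. *)
Lemma pos_on_qform_le0 M N x : N \is symmetricmx ->
  (forall y, y != 0 -> qform N y <= 0 -> qform M y != 0) ->
  qform N x <= 0 -> 0 < qform M x ->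
  forall d, d != 0 -> qform N d <= 0 -> 0 < qform M d.
Proof.
move=> sN MN Nx Mx d d0 Nd.
wlog b0 : d d0 Nd / bform N x d <= 0 => [wl|].
  have [/wl|/ltW b0] := leP (bform N x d) 0; first exact.
  by rewrite -qformN; apply: wl; rewrite ?oppr_eq0 ?qformN ?bformNr ?oppr_le0.
rewrite lt_neqAle eq_sym MN//= leNgt; apply/negP => Md.
have [t [y0 /eqP]] := qform_root_on_segment Mx Md.
apply/negP/MN => //; rewrite qform_comb//.
have t2 : 0 <= t ^+ 2 by exact: sqr_ge0.
have s2 : 0 <= (1 - t) ^+ 2 by exact: sqr_ge0.
have p1 := mulr_ge0_le0 (sqr_ge0 ((1 - t) ^+ 2)) Nx.
have p2 := mulr_ge0_le0 (mulr_ge0 s2 t2) b0.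
have p3 := mulr_ge0_le0 (sqr_ge0 (t ^+ 2)) Nd.
lra.
Qed.

(** Orthogonal isotropic vectors span a totally isotropic subspace, so the segment
between them stays in the cone. *)
Lemma pos_on_isotropic_orthogonal M N x d : N \is symmetricmx ->
  (forall y, y != 0 -> qform N y = 0 -> qform M y != 0) ->
  qform N x = 0 -> qform N d = 0 -> bform N x d = 0 ->
  d != 0 -> 0 < qform M x -> 0 < qform M d.
Proof.
move=> sN MN Nx Nd b0 d0 Mx.
rewrite lt_neqAle eq_sym MN//= leNgt; apply/negP => Md.
have [t [y0 /eqP]] := qform_root_on_segment Mx Md.
by apply/negP/MN => //; rewrite qform_comb// Nx Nd b0 !mulr0 mul0rn !addr0.
Qed.

(** Let e be nonzero and N-orthogonal to x and d.  If e is isotropic, x and d are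
joined through e by two isotropic segments.  Otherwise, up to the sign of d, a
multiple of e bends the segment from x to d into an isotropic path. *)
Lemma pos_on_qform_eq0 M N x : (3 <= n)%N -> N \is symmetricmx ->
  (forall y, y != 0 -> qform N y = 0 -> qform M y != 0) ->
  qform N x = 0 -> 0 < qform M x ->
  forall d, d != 0 -> qform N d = 0 -> 0 < qform M d.
Proof.
move=> n3 sN MN Nx Mx d d0 Nd.
have orth := pos_on_isotropic_orthogonal sN MN.
have [b0|b0] := eqVneq (bform N x d) 0; first exact: orth Mx.
have [e [e0 xe de]] := exists_orthogonal2 N x d n3.
have [Ne|Ne] := eqVneq (qform N e) 0.
  by apply: (orth e) => //; [rewrite bformC|exact: (orth x)].
wlog be : d d0 Nd b0 de / bform N x d * qform N e < 0 => [wl|].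
  have [/wl|] := ltP (bform N x d * qform N e) 0; first exact.
  rewrite le_eqVlt eq_sym mulf_eq0 (negbTE b0) (negbTE Ne)/= => be.
  rewrite -qformN; apply: wl; rewrite ?oppr_eq0 ?qformN ?bformNr ?oppr_eq0//.
    by rewrite bformC// bformNr bformC// de oppr0.
  by rewrite mulNr oppr_lt0.
rewrite lt_neqAle eq_sym MN//= leNgt; apply/negP => Md.
pose c := Num.sqrt (- 2 * bform N x d / qform N e).
have c2 : c ^+ 2 * qform N e = - 2 * bform N x d.
  rewrite sqr_sqrtr; first by rewrite divfK.
  have -> : - 2 * bform N x d / qform N e =
      - 2 * (bform N x d * qform N e) / qform N e ^+ 2.
    by field.
  by rewrite divr_ge0 ?sqr_ge0// mulr_le0// ltW// oppr_lt0.
have [t _ yt] := qform_root_on_path (c *: e) Mx Md.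
move: yt; set y := _ + _ => yt.
have Ny : qform N y = 0.
  rewrite /y scalerA -[X in X + _]scale1r qform_comb// expr1n qform_comb//.
  rewrite bformDl !bformZl xe de Nx Nd.
  transitivity (((1 - t) * t) ^+ 2 * (2 * bform N x d + c ^+ 2 * qform N e)).
    by ring.
  by rewrite c2; ring.
(* pairing y with x leaves only t^2 bform N x d, so y = 0 would force t = 0 *)
have y0 : y != 0.
  apply/eqP => y0; have : bform N x y = 0 by rewrite y0 /bform mulmx0 mxE.
  rewrite /y !bformDr !bformZr -qform_bform Nx xe !mulr0 add0r addr0.
  move=> /eqP; rewrite mulf_eq0 (negbTE b0) orbF sqrf_eq0 => /eqP t0.
  move: yt; rewrite /y t0 subr0 expr1n expr0n/= mulr0 !scale0r scale1r !addr0.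
  by move=> M0; rewrite M0 ltxx in Mx.
by have := MN y y0 Ny; rewrite yt eqxx.
Qed.

(** * Compact slices of cones *)

(** With C the maximum of the sum of squares I on the slice, rescaling gives
I <= C M on the part of the cone where M > 0.  A zero of C M - I / 2 on the cone
would have C M = I / 2 > 0, contradicting I <= C M unless it is the origin. *)
Lemma compact_slice M (D : set 'cV[R]_n) (S := [set x | qform M x = 1 /\ D x]) :
  (forall a x, D x -> D (a *: x)) -> S !=set0 -> compact S ->
  exists C : R, let Q := C *: M - 2^-1 *: 1%:M in
    (exists x, D x /\ 0 < qform Q x) /\
    (forall x, x != 0 -> D x -> qform Q x != 0).
Proof.
move=> DZ S0 cS.
have ct : {within S, continuous (qform 1%:M)}.
  by apply: continuous_subspaceT; exact: qform_continuous.
have [a /set_mem[Ma Da] amax] := compact_EVT_max S0 cS ct.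
have a0 : 0 < qform 1%:M a.
  apply: qform1_gt0; apply/eqP => a0; move/eqP: Ma.
  by rewrite a0 qform0 eq_sym oner_eq0.
exists (qform 1%:M a) => /=; split=> [|x x0 Dx].
  exists a; split=> //; rewrite qformDm qformNm !qformZm Ma; lra.
rewrite qformDm qformNm !qformZm subr_eq0; apply/eqP => h.
have xx := qform1_gt0 x0.
have Mx : 0 < qform M x by rewrite -(pmulr_rgt0 _ a0) h mulr_gt0// invr_gt0.
have := amax ((Num.sqrt (qform M x))^-1 *: x).
rewrite qformZ exprVn sqr_sqrtr ?(ltW Mx)// mulrC ler_pdivrMr// h => H.
have : qform 1%:M x <= 2^-1 * qform 1%:M x.
  apply: H; apply/mem_set; split; last exact: DZ.
  by rewrite qformZ exprVn sqr_sqrtr ?(ltW Mx)// mulVf ?gt_eqF.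
lra.
Qed.

End Forms.

Theorem theorem2p8 (R : realType) (n : nat) (A1 A2 : 'M[R]_n)
    (hn : (3 <= n)%N) (hA1 : A1 \is symmetricmx) (hA2 : A2 \is symmetricmx) :
  (setE A1 A2 !=set0 ->
     (compact (setE A1 A2) <->
      exists mu1 mu2 : R, posdefmx (mu1 *: A1 + mu2 *: A2)))
  /\
  (setF A1 A2 !=set0 ->
     (compact (setF A1 A2) <->
      exists mu : R, posdefmx (mu *: A1 + A2))).
Proof.
have sD : A2 - A1 \is symmetricmx.
  by rewrite -scaleN1r symmetricmxD// symmetricmxZ.
have sQ C : C *: A1 - 2^-1 *: 1%:M \is symmetricmx.
  by rewrite -scaleNr symmetricmxD// symmetricmxZ// symmetricmx1.
split=> [E0|F0]; split.
- have EE : setE A1 A2 = [set x | qform A1 x = 1 /\ qform (A2 - A1) x = 0].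
    apply/seteqP; split=> x /=; rewrite /setE/= qformDm qformNm.
      by move=> [-> ->]; rewrite subrr.
    by move=> [-> /eqP]; rewrite subr_eq0 => /eqP ->.
  move: E0; rewrite EE => E0 /compact_slice [||C [[x [Dx Qx]] QD]] //.
    by move=> a y /= h; rewrite qformZ h mulr0.
  have Qpos := pos_on_qform_eq0 hn sD QD Dx Qx.
  have [l lP] := finsler (sQ C) sD Qpos.
  exists (C - l), l; split; first by rewrite symmetricmxD// symmetricmxZ.
  move=> y /qform1_gt0 y0; have := lP y.
  rewrite !(qformDm, qformNm, qformZm); nra.
- move=> [m1 [m2 /posdef_coercive[l l0 lP]]].
  apply: (@compact_qform1_bounded _ _ (l * (m1 + m2))).
    by apply: closedI; exact: closed_qform_eq.
  move=> x [/= x1 x2]; have := lP x.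
  by rewrite qformDm !qformZm x1 x2 !mulr1.
- have FE : setF A1 A2 = [set x | qform A1 x = 1 /\ qform (A2 - A1) x <= 0].
    apply/seteqP; split=> x /= [x1];
      by rewrite /setF/= qformDm qformNm x1 subr_le0.
  move: F0; rewrite FE => F0 /compact_slice [||C [[x [Dx Qx]] QD]] //.
    by move=> a y /= h; rewrite qformZ mulr_ge0_le0// sqr_ge0.
  have Qpos := pos_on_qform_le0 sD QD Dx Qx.
  have [|l0 l0P] := finsler (sQ C) sD; first by move=> y y0 h; rewrite Qpos// h.
  (* if l0 <= 0, the form is nonnegative where q > 0 by l0P and elsewhere by Qpos *)
  have [l lge0 lP] : exists2 l, 0 <= l & forall y,
      0 <= qform (C *: A1 - 2^-1 *: 1%:M) y + l * qform (A2 - A1) y.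
    have [/ltW|l0_le0] := ltP 0 l0; first by exists l0.
    exists 0 => // y; rewrite mul0r addr0.
    have [y0|y0] := leP (qform (A2 - A1) y) 0.
      by have [->|/Qpos/(_ y0)/ltW//] := eqVneq y 0; rewrite qform0.
    by have := l0P y; nra.
  have [k k0 kP] := qform1_dominates (A2 - A1).
  (* small enough for e * q >= - I / 4, leaving I / 4 of the reserve I / 2 *)
  pose e := (4 * k)^-1.
  have e0 : 0 < e by rewrite invr_gt0 mulr_gt0.
  have le0 : 0 < l + e by rewrite ltr_wpDl.
  exists (C / (l + e) - 1); split; first by rewrite symmetricmxD// symmetricmxZ.
  move=> y /qform1_gt0 y0.
  rewrite -(pmulr_rgt0 _ le0) qformDm qformZm.
  have -> : (l + e) * ((C / (l + e) - 1) * qform A1 y + qform A2 y) =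
     C * qform A1 y + (l + e) * (qform A2 y - qform A1 y).
    by field; rewrite gt_eqF.
  have ek : e * k = 4^-1 by rewrite /e; field; rewrite gt_eqF.
  have := mulr_ge0 (ltW e0) (kP y); rewrite mulrDr mulrA ek.
  have := lP y; rewrite !(qformDm, qformNm, qformZm); nra.
- move=> [m /posdef_coercive[l l0 lP]].
  apply: (@compact_qform1_bounded _ _ (l * (m + 1))).
    by apply: closedI; [exact: closed_qform_eq|exact: closed_qform_le].
  move=> x [/= x1 x2]; apply: le_trans (lP x) _.
  by rewrite qformDm !qformZm x1 mulr1 ler_pM2l// lerD2l.
Qed.
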